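(* There does not exist a constant $c$ such that either one of the following holds for all inclusions of finite graphs $H\hookrightarrow G$ with $G$ connected: 1. $h_0^{H,G}\le c\cdot h_{\mathrm{Kron}}^{H,G}$; 2. $\varphi_0^{H,G}\le c\cdot\varphi_{\mathrm{Kron}}^{H,G}$. That is, for every constant $c$, inequality 1 fails for some such inclusion, and inequality 2 fails for some such inclusion.
   Context: Inclusions with $|V^H|\ge2$ are considered. Let $G=(V^G,E^G)$ be a finite simple graph and $H=(V^H,E^H)$ a subgraph. View graphs as $1$-dimensional simplicial complexes with oriented edges; $C_0,C_1$ are real chains with the inner product for which simplices are orthonormal. Let $B$ and $D$ be the submatrices of the incidence matrix of $G$ (matrix of $\partial_1^G:C_1^G\to C_0^G$) with rows indexed by $V^H$ and by $V^G\setminus V^H$. Let $C_1^{G,H}=\{c\in C_1^G:\partial_1^Gc\in C_0^H\}=\ker D$, and let $P:C_1^G\to C_1^G$ be the orthogonal projection onto $C_1^{G,H}$. The persistent Laplacian is $\Delta_0^{H,G}=\partial_1^{G,H}(\partial_1^{G,H})^*=BPB^T$ on $C_0^H=\mathbb{R}^{V^H}$, where $\partial_1^{G,H}:C_1^{G,H}\to C_0^H$ is the restriction of $\partial_1^G$. For $A\subseteq V^H$, $\chi_A\in\mathbb{R}^{V^H}$ is its indicator vector. Define $$h_{\mathrm{Kron}}^{H,G}=\min_{\substack{V^H=H_1\sqcup H_2\\ H_1,H_2\ne\varnothing}}\frac{|V^H|\,\chi_{H_1}^T\Delta_0^{H,G}\chi_{H_1}}{|H_1||H_2|},\qquad \varphi_{\mathrm{Kron}}^{H,G}=\min_{\substack{\varnothing\ne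 H_1\subseteq V^H\\ |H_1|\le|V^H|/2}}\frac{\chi_{H_1}^T\Delta_0^{H,G}\chi_{H_1}}{|H_1|},$$ $$h_0^{H,G}=\min_{\substack{V^H=H_1\sqcup H_2,\ V^G=G_1\sqcup G_2\\ \varnothing\ne H_i\subseteq G_i}}\frac{|V^H|\,|E(G_1,G_2)|}{|H_1||H_2|},\qquad \varphi_0^{H,G}=\min_{\substack{0\ne x\in\mathbb{R}^{V^H}\\ x\perp^1\ker(PB^T)}}\frac{\|PB^Tx\|_1}{\|x\|_1},$$ where $E(G_1,G_2)$ is the set of edges of $G$ between $G_1$ and $G_2$, and $x\perp^1Y$ means $\|x+y\|_1\ge\|x\|_1$ for all $y\in Y$. *)

(* Defs.v *)
From mathcomp Require Import all_boot all_order all_algebra.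
From mathcomp Require Import classical_sets reals.

Set Implicit Arguments.
Unset Strict Implicit.
Unset Printing Implicit Defensive.

Import Order.TTheory GRing.Theory Num.Theory.
Local Open Scope ring_scope.

Record sgraph := SGraph {
  vertex :> finType;
  adj : rel vertex;
  adj_sym : symmetric adj;
  adj_irr : irreflexive adj }.

Record subgraph (G : sgraph) := Subgraph {
  subV : {set G};
  subE : rel G;
  subE_sym : symmetric subE;
  subE_adj : forall x y, subE x y -> [&& adj x y, x \in subV & y \in subV] }.

Definition graph_connected (G : sgraph) : Prop :=
  forall x y : G, connect (@adj G) x y.

(* The edge {x, y} is represented once, oriented from the endpoint of smaller
   rank in the enumeration of the vertices to the one of larger rank. None of
   the quantities below depends on the choice of orientation. *)
Definition edges (G : sgraph) : {set G * G} :=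
  [set p : G * G | adj p.1 p.2 & (enum_rank p.1 < enum_rank p.2)%N].

Definition edges_between (G : sgraph) (G1 G2 : {set G}) : {set G * G} :=
  [set p in edges G | (p.1 \in G1) && (p.2 \in G2)
                      || (p.1 \in G2) && (p.2 \in G1)].

Definition bipartition (T : finType) (A A1 A2 : {set T}) : bool :=
  (A1 :|: A2 == A) && [disjoint A1 & A2].

(* Rows indexed by A of the matrix of the boundary operator, which sends the
   edge oriented from p.1 to p.2 to the chain p.2 - p.1. *)
Definition incidence_rows (R : realType) (G : sgraph) (A : {set G}) :
    'M[R]_(#|A|, #|edges G|) :=
  \matrix_(i, j) ((enum_val i == (enum_val j).2)%:R
                  - (enum_val i == (enum_val j).1)%:R).

(* In MathComp subspaces are row spaces: the rows of [orthoc A] span the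
   orthogonal complement of the row space of A. *)
Definition orthoc (R : realType) (m n : nat) (A : 'M[R]_(m, n)) : 'M[R]_n :=
  kermx A^T.

Section PersistentLaplacian.
Variables (R : realType) (G : sgraph) (H : subgraph G).

Definition matB : 'M[R]_(#|subV H|, #|edges G|) := incidence_rows R (subV H).

Definition matD : 'M[R]_(#|~: subV H|, #|edges G|) :=
  incidence_rows R (~: subV H).

(* The row space of [chainsGH] is {c | D c = 0}, chains being transposed into
   row vectors. *)
Definition chainsGH : 'M[R]_#|edges G| := kermx matD^T.

(* [proj_mx] acts on row vectors by right multiplication; the transpose acts on
   column vectors by left multiplication. *)
Definition matP : 'M[R]_#|edges G| := (proj_mx chainsGH (orthoc chainsGH))^T.

Definition pers_laplacian : 'M[R]_#|subV H| := matB *m matP *m matB^T.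

Definition indicator (A : {set G}) : 'cV[R]_#|subV H| :=
  \col_i (enum_val i \in A)%:R.

Definition quad_form (A : {set G}) : R :=
  ((indicator A)^T *m pers_laplacian *m indicator A) 0 0.

Definition norm1 (n : nat) (x : 'cV[R]_n) : R := \sum_i `|x i 0|.

Definition perp1_ker (m n : nat) (M : 'M[R]_(m, n)) (x : 'cV[R]_n) : Prop :=
  forall y : 'cV[R]_n, M *m y = 0 -> norm1 x <= norm1 (x + y).

(* All the infima below are minima when G is connected and V^H has at least two
   vertices: the first three range over finite nonempty sets of values, and the
   last one is that of a function that is continuous and homogeneous of degree
   0 on the nonzero vectors of a closed cone, which contains the difference of
   two distinct basis vectors since ker (P B^T) is spanned by the all-ones
   vector. *)

Definition h_Kron : R :=
  inf [set q : R | exists H1 H2 : {set G},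
    [/\ bipartition (subV H) H1 H2, (0 < #|H1|)%N, (0 < #|H2|)%N
      & q = #|subV H|%:R * quad_form H1 / (#|H1|%:R * #|H2|%:R)]]%classic.

Definition phi_Kron : R :=
  inf [set q : R | exists H1 : {set G},
    [/\ H1 \subset subV H, (0 < #|H1|)%N,
        (#|H1|%:R <= #|subV H|%:R / 2 :> R)
      & q = quad_form H1 / #|H1|%:R]]%classic.

Definition h_0 : R :=
  inf [set q : R | exists H1 H2 G1 G2 : {set G},
    [/\ bipartition (subV H) H1 H2, bipartition [set: G]%SET G1 G2,
        (0 < #|H1|)%N /\ H1 \subset G1,
        (0 < #|H2|)%N /\ H2 \subset G2
      & q = #|subV H|%:R * #|edges_between G1 G2|%:R
            / (#|H1|%:R * #|H2|%:R)]]%classic.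

Definition phi_0 : R :=
  inf [set q : R | exists x : 'cV[R]_#|subV H|,
    [/\ x != 0, perp1_ker (matP *m matB^T) x
      & q = norm1 (matP *m matB^T *m x) / norm1 x]]%classic.

End PersistentLaplacian.

(* Main.v *)
(* Take for G the path with n edges and for H its two end vertices. The effective
   conductance between the ends is 1/n, so h_Kron <= 2/n and phi_Kron <= 1/n.
   On the other hand every cut of a connected graph has an edge, so h_0 >= 2; and
   the unit flow s (all ones) along the path satisfies D s = 0 and
   B s = e_end - e_start, so the entries of P B^T x sum up to x_end - x_start,
   whose absolute value is at least |x|_1 when x is 1-orthogonal to the constants:
   hence phi_0 >= 1. Both ratios are therefore at least n. *)

Require Import Defs.
From mathcomp Require Import all_boot all_order all_algebra.
From mathcomp Require Import reals.
From mathcomp Require Import zify ring lra.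

Set Implicit Arguments.
Unset Strict Implicit.
Unset Printing Implicit Defensive.

Import Order.TTheory GRing.Theory Num.Theory.
Local Open Scope ring_scope.

(** * Linear algebra of the orthogonal projection *)

Lemma norm1_gt0 (R : realType) (n : nat) (x : 'cV[R]_n) : x != 0 -> 0 < norm1 x.
Proof.
move=> x_neq0; rewrite lt_def sumr_ge0 // andbT.
apply: contraNneq x_neq0 => /eqP; rewrite psumr_eq0 // => /allP x0.
apply/eqP/colP => i; rewrite mxE; apply/eqP.
by rewrite -normr_eq0 (implyP (x0 i (mem_index_enum i))).
Qed.

Lemma row_sqr_eq0 (R : realType) (n : nat) (v : 'rV[R]_n) :
  v *m v^T = 0 -> v = 0.
Proof.
move=> /matrixP/(_ 0 0); rewrite !mxE => /eqP.
rewrite psumr_eq0 => [|i _]; last by rewrite mxE -expr2 sqr_ge0.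
move=> /allP v0; apply/rowP => i; apply/eqP.
have := v0 i (mem_index_enum i).
by rewrite mxE -expr2 sqrf_eq0 mxE.
Qed.

(** A row [v = u A] with [v A^T = 0] satisfies [v v^T = v A^T u^T = 0], and over the reals this
    forces [v = 0]. *)
Lemma cap_orthoc (R : realType) (n : nat) (A : 'M[R]_n) :
  (A :&: orthoc A)%MS = 0.
Proof.
apply/eqP; rewrite -submx0; apply/rV_subP => v; rewrite sub_capmx.
case/andP => /submxP[u def_v]; rewrite sub_kermx => /eqP vA0.
suff -> : v = 0 by rewrite sub0mx.
by apply: row_sqr_eq0; rewrite {2}def_v trmx_mul mulmxA vA0 mul0mx.
Qed.

Lemma sub_add_orthoc (R : realType) (m n : nat) (A : 'M[R]_n)
    (W : 'M[R]_(m, n)) :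
  (W <= A + orthoc A)%MS.
Proof.
apply: submx_full; rewrite /row_full mxrank_disjoint_sum ?cap_orthoc //.
by rewrite mxrank_ker mxrank_tr subnKC ?rank_leq_row.
Qed.

(** The rows of [p] lie in the row space of [A] and those of [1 - p] are orthogonal to it, so
    [(1 - p) p^T = 0]. Symmetry and idempotence of [p] both follow from this one identity. *)
Lemma proj_orthoc_mul_tr (R : realType) (n : nat) (A : 'M[R]_n) :
  let p := proj_mx A (orthoc A) in p *m p^T = p^T.
Proof.
move=> p; have /submxP[U def_p] : (p <= A)%MS.
  by rewrite -[p]mul1mx proj_mx_sub.
have : (1%:M - p <= orthoc A)%MS.
  by rewrite -[p]mul1mx proj_mx_compl_sub ?sub_add_orthoc.
rewrite sub_kermx => /eqP pA0; apply/esym/eqP; rewrite -subr_eq0.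
rewrite -{1}[p^T]mul1mx -mulmxBl; apply/eqP.
by rewrite {2}def_p trmx_mul mulmxA pA0 mul0mx.
Qed.

Lemma matP_sym (R : realType) (G : sgraph) (H : subgraph G) :
  (matP R H)^T = matP R H.
Proof.
by rewrite /matP trmxK -{1}[proj_mx _ _]trmxK -proj_orthoc_mul_tr trmx_mul trmxK
  proj_orthoc_mul_tr.
Qed.

Lemma matP_idem (R : realType) (G : sgraph) (H : subgraph G) :
  matP R H *m matP R H = matP R H.
Proof. by rewrite -{1}matP_sym /matP trmxK proj_orthoc_mul_tr. Qed.

Lemma matP_cycle (R : realType) (G : sgraph) (H : subgraph G)
    (s : 'cV[R]_#|edges G|) :
  matD R H *m s = 0 -> matP R H *m s = s.
Proof.
move=> Ds0; apply: trmx_inj; rewrite trmx_mul /matP trmxK.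
rewrite proj_mx_id ?cap_orthoc // sub_kermx -trmx_mul Ds0.
by rewrite trmx0.
Qed.

(** The columns of [D^T] are orthogonal to [ker D], the space onto which [matP] projects. *)
Lemma matP_matD (R : realType) (G : sgraph) (H : subgraph G) :
  matP R H *m (matD R H)^T = 0.
Proof.
apply: trmx_inj; rewrite trmx_mul /matP !trmxK trmx0.
rewrite proj_mx_0 ?cap_orthoc // sub_kermx.
have /(congr1 trmx) := mulmx_ker (matD R H)^T.
by rewrite trmx_mul trmxK trmx0 => ->.
Qed.

(** * Functions on the vertices and their coboundaries *)

Definition restr (R : realType) (G : sgraph) (A : {set G}) (f : G -> R) :
    'cV[R]_#|A| :=
  \col_i f (enum_val i).

Lemma restrD (R : realType) (G : sgraph) (A : {set G}) (f g : G -> R) :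
  restr A f + restr A g = restr A (fun v => f v + g v).
Proof. by apply/colP => i; rewrite !mxE. Qed.

Lemma restr_surj (R : realType) (G : sgraph) (A : {set G}) (x : 'cV[R]_#|A|) :
  exists f : G -> R, x = restr A f.
Proof.
(* This extends [x] by zero: [enum_val] being injective, the sum has one term for [v] in [A] and
   none otherwise. *)
exists (fun v => \sum_(i | enum_val i == v) x i 0); apply/colP => i.
by rewrite mxE (big_pred1 i) // => j; rewrite /= (inj_eq enum_val_inj).
Qed.

Definition grad (R : realType) (G : sgraph) (f : G -> R) :
    'cV[R]_#|edges G| :=
  \col_j (f (enum_val j).2 - f (enum_val j).1).

Lemma incidence_rows_tr_mul (R : realType) (G : sgraph) (A : {set G})
    (f : G -> R) (j : 'I_#|edges G|) :
  ((incidence_rows R A)^T *m restr A f) j 0 =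
  ((enum_val j).2 \in A)%:R * f (enum_val j).2
  - ((enum_val j).1 \in A)%:R * f (enum_val j).1.
Proof.
have pick_sum (v : G) :
    \sum_(i < #|A|) (enum_val i == v)%:R * f (enum_val i)
    = (v \in A)%:R * f v.
  rewrite -(big_enum_val (A := mem A) (fun x => (x == v)%:R * f x)) /=.
  have [vA|vA] := boolP (v \in A).
    rewrite (bigD1 v) //= eqxx big1 ?addr0 // => x /andP[_ /negPf->].
    by rewrite mul0r.
  rewrite big1 ?mul0r // => x xA; case: eqP => [xv|_]; last by rewrite mul0r.
  by rewrite -xv xA in vA.
rewrite mxE -!pick_sum -sumrB; apply: eq_bigr => i _.
by rewrite !mxE mulrBl.
Qed.

(** Each endpoint of an edge lies in exactly one of [subV H] and its complement. *)
Lemma coboundary_split (R : realType) (G : sgraph) (H : subgraph G)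
    (f : G -> R) :
  (matB R H)^T *m restr (subV H) f + (matD R H)^T *m restr (~: subV H) f
  = grad f.
Proof.
apply/colP => j; rewrite mxE !incidence_rows_tr_mul !mxE !inE.
by do 2 case: (_ \in subV H); rewrite /= ?mul1r ?mul0r; ring.
Qed.

(** Since [P D^T = 0], the vector [P B^T x] can be computed from the gradient of any extension of
    [x] to all of [G]. *)
Lemma matP_grad (R : realType) (G : sgraph) (H : subgraph G) (f : G -> R) :
  matP R H *m (matB R H)^T *m restr (subV H) f = matP R H *m grad f.
Proof.
rewrite -(coboundary_split H) mulmxDr [X in _ + X]mulmxA matP_matD mul0mx.
by rewrite addr0 mulmxA.
Qed.

(** As [P] is symmetric and idempotent, [B P B^T = (P B^T)^T (P B^T)]. *)
Lemma quad_form_sum_sqr (R : realType) (G : sgraph) (H : subgraph G)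
    (A : {set G}) :
  quad_form R H A
  = \sum_j (matP R H *m (matB R H)^T *m indicator R H A) j 0 ^+ 2.
Proof.
pose u := matP R H *m (matB R H)^T *m indicator R H A.
transitivity ((u^T *m u) 0 0); last first.
  by rewrite mxE; apply: eq_bigr => j _; rewrite mxE.
rewrite /u !trmx_mul matP_sym trmxK !mulmxA /quad_form /pers_laplacian.
by rewrite -[X in _ = (X *m _ *m _) _ _]mulmxA matP_idem !mulmxA.
Qed.

Lemma quad_form_ge0 (R : realType) (G : sgraph) (H : subgraph G)
    (A : {set G}) :
  0 <= quad_form R H A.
Proof. by rewrite quad_form_sum_sqr sumr_ge0 // => j _; rewrite sqr_ge0. Qed.

(** Without an edge across the cut, [G1] would be closed under adjacency, and connectivity would put
    a vertex of [G2] in it. *)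
Lemma edges_between_gt0 (G : sgraph) (G1 G2 : {set G}) :
  graph_connected G -> bipartition [set: G] G1 G2 ->
  (0 < #|G1|)%N -> (0 < #|G2|)%N -> (0 < #|edges_between G1 G2|)%N.
Proof.
move=> conG /andP[/eqP G12 dG] /card_gt0P[x xG1] /card_gt0P[y yG2].
have in2 z : (z \in G2) = (z \notin G1).
  have := in_setT z; rewrite -G12 inE.
  by have [/(disjointFr dG)->|] := boolP (z \in G1).
rewrite card_gt0; apply/negP => /eqP noE.
suff cl : closed (@adj G) (mem G1).
  by move: yG2; rewrite in2 -(closed_connect cl (conG x y)) xG1.
move=> u v uv; have [|u1] := eqVneq (u \in G1) (v \in G1); first by [].
have uv_neq : (enum_rank u : nat) != enum_rank v.
  by apply: contraNneq u1 => /val_inj/enum_rank_inj ->.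
(* An edge is stored only in the order of increasing rank, so the pair to test is [(u, v)] or
   [(v, u)] accordingly. *)
have [lt|le] := ltnP (enum_rank u) (enum_rank v).
  have := in_set0 (u, v); rewrite -noE !inE /= uv lt !in2.
  by case: (u \in G1) u1; case: (v \in G1).
have lt : (enum_rank v < enum_rank u)%N by rewrite ltn_neqAle eq_sym uv_neq.
have := in_set0 (v, u); rewrite -noE !inE /= adj_sym uv lt !in2.
by case: (u \in G1) u1; case: (v \in G1).
Qed.

(** * The path with [n] edges and its two ends *)

Definition path_adj (n : nat) : rel 'I_n.+1 :=
  fun i j => (i.+1 == j :> nat) || (j.+1 == i :> nat).

Lemma path_adj_sym (n : nat) : symmetric (@path_adj n).
Proof. by move=> i j; rewrite /path_adj orbC. Qed.

Lemma path_adj_irr (n : nat) : irreflexive (@path_adj n).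
Proof. by move=> i; rewrite /path_adj orbb gtn_eqF. Qed.

Definition path_graph (n : nat) : sgraph :=
  SGraph (@path_adj_sym n) (@path_adj_irr n).

Definition ends (n : nat) : {set path_graph n} := [set ord0; ord_max].

Lemma ends_subE (n : nat) (x y : path_graph n) :
  false -> [&& adj x y, x \in ends n & y \in ends n].
Proof. by []. Qed.

Definition path_ends (n : nat) : subgraph (path_graph n) :=
  @Subgraph (path_graph n) (ends n) (fun _ _ => false)
    (fun _ _ => erefl) (@ends_subE n).

Lemma path_connected (n : nat) : graph_connected (path_graph n).
Proof.
have con0 (i : path_graph n) : connect (@adj (path_graph n)) ord0 i.
  case: i => i; elim: i => [|i IHi] lt_in.
    by rewrite (_ : Ordinal _ = ord0) ?connect0 //; apply: val_inj.
  apply: connect_trans (IHi (ltnW lt_in)) (connect1 _).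
  by rewrite /= /path_adj /= eqxx.
move=> x y; apply: connect_trans (con0 y).
by rewrite (sym_connect_sym (@adj_sym (path_graph n))).
Qed.

Lemma card_ends (n : nat) : (0 < n)%N -> #|ends n| = 2%N.
Proof. by move=> n0; rewrite cards2 -val_eqE /= eq_sym -lt0n n0. Qed.

Definition path_edge (n : nat) (i : 'I_n) : path_graph n * path_graph n :=
  (widen_ord (leqnSn n) i, lift ord0 i).

Lemma path_edge_inj (n : nat) : injective (@path_edge n).
Proof. by move=> i j [/val_inj]. Qed.

Lemma path_edge_succ (n : nat) (e : path_graph n * path_graph n) :
  e \in edges (path_graph n) -> e.2 = e.1.+1 :> nat.
Proof.
by rewrite inE !enum_rank_ord /= /path_adj => /andP[/orP[/eqP|/eqP] + +]; lia.
Qed.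

Lemma path_edges (n : nat) : edges (path_graph n) = [set path_edge i | i in 'I_n].
Proof.
apply/setP => -[x y]; apply/idP/imsetP => [/path_edge_succ/= xy|[i _ [-> ->]]].
  have xn : (x < n)%N by have := ltn_ord y; lia.
  by exists (Ordinal xn) => //; congr pair; apply: val_inj.
by rewrite inE !enum_rank_ord /= /path_adj /= eqxx /bump /= add1n.
Qed.

Lemma sum_path_edges (V : zmodType) (n : nat)
    (F : path_graph n * path_graph n -> V) :
  \sum_(j < #|edges (path_graph n)|) F (enum_val j)
  = \sum_(i < n) F (path_edge i).
Proof.
rewrite -(big_enum_val (A := mem (edges (path_graph n))) F) path_edges.
by rewrite big_imset //= => x y _ _ /path_edge_inj.
Qed.

Lemma sum_ends (V : zmodType) (n : nat) (F : path_graph n -> V) :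
  (0 < n)%N -> \sum_(i < #|ends n|) F (enum_val i) = F ord0 + F ord_max.
Proof.
move=> n0; rewrite -(big_enum_val (A := mem (ends n)) F) big_setU1 ?big_set1 //.
by rewrite inE -val_eqE /= eq_sym -lt0n.
Qed.

(** The boundary of the all-ones chain telescopes along the path, so only the two ends survive. *)
Lemma incidence_rows_path (R : realType) (n : nat) (A : {set path_graph n})
    (i : 'I_#|A|) :
  (incidence_rows R A *m (const_mx 1 : 'cV_#|edges (path_graph n)|)) i 0
  = (enum_val i == ord_max)%:R - (enum_val i == ord0)%:R.
Proof.
pose v := enum_val i.
rewrite mxE (eq_bigr (fun j => (v == (enum_val j).2)%:R - (v == (enum_val j).1)%:R));
  last by move=> j _; rewrite !mxE mulr1.
rewrite (sum_path_edges (fun p => (v == p.2)%:R - (v == p.1)%:R)) /=.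
pose f (k : nat) : R := (val v == k)%:R.
rewrite (eq_bigr (fun j : 'I_n => f j.+1 - f j)); last first.
  by move=> j _; rewrite /f -!val_eqE /= /bump.
by rewrite -(big_mkord xpredT (fun k => f k.+1 - f k)) telescope_sumr.
Qed.

(** * Bounds for the four constants of the path *)

Section Path.
Context (R : realType) (n : nat) (n_gt0 : (0 < n)%N).
Let G := path_graph n.
Let H := path_ends n.
Let s : 'cV[R]_#|edges G| := const_mx 1.

Lemma matD_ones : matD R H *m s = 0.
Proof.
apply/colP => i; rewrite incidence_rows_path mxE.
have := enum_valP i; rewrite !inE negb_or => /andP[/negPf-> /negPf->].
by rewrite subrr.
Qed.

(** The sum is [s^T P B^T f = (B P s)^T f], and [P s = s] because [D s = 0]; then [B s] is read off
    at the two ends. *)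
Lemma sum_flow (f : G -> R) :
  \sum_j (matP R H *m (matB R H)^T *m restr (subV H) f) j 0
  = f ord_max - f ord0.
Proof.
transitivity ((s^T *m (matP R H *m (matB R H)^T *m restr (subV H) f)) 0 0).
  by rewrite mxE; apply: eq_bigr => j _; rewrite !mxE mul1r.
rewrite !mulmxA -{1}matP_sym -trmx_mul (matP_cycle matD_ones) -trmx_mul.
rewrite mxE (eq_bigr (fun i => ((enum_val i == ord_max :> G)%:R -
  (enum_val i == ord0 :> G)%:R) * f (enum_val i))); last first.
  by move=> i _; rewrite mxE incidence_rows_path mxE.
rewrite (sum_ends (fun v => ((v == ord_max)%:R - (v == ord0)%:R) * f v)) //.
by rewrite -!val_eqE /= !eqxx (ltn_eqF n_gt0) (gtn_eqF n_gt0) /=; ring.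
Qed.

(** The harmonic extension of the indicator is the linear potential [v / n]. Its gradient is the
    constant [1 / n], a multiple of [s], hence fixed by [P]. *)
Lemma quad_form_end : quad_form R H [set ord_max] = n%:R^-1.
Proof.
have n0 : n%:R != 0 :> R by rewrite pnatr_eq0 -lt0n.
pose f (v : G) : R := v%:R / n%:R.
have ind_f : indicator R H [set ord_max] = restr (subV H) f.
  apply/colP => i; rewrite !mxE inE /f.
  have /set2P[->|->] := enum_valP i.
    by rewrite -val_eqE /= (ltn_eqF n_gt0) mul0r.
  by rewrite eqxx /= divff.
have flow_f j : (matP R H *m (matB R H)^T *m restr (subV H) f) j 0 = n%:R^-1.
  have -> : matP R H *m (matB R H)^T *m restr (subV H) f = n%:R^-1 *: s.
    have grad_f : grad f = n%:R^-1 *: s.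
      apply/colP => k; rewrite !mxE mulr1 /f.
      by rewrite -mulrBl (path_edge_succ (enum_valP k)) mulrSr addrC addKr div1r.
    by rewrite matP_grad grad_f matP_cycle // -scalemxAr matD_ones scaler0.
  by rewrite !mxE mulr1.
rewrite quad_form_sum_sqr ind_f.
(* Replacing only one factor of each square by [1 / n] leaves [1 / n] times the total flow, which
   [sum_flow] evaluates to 1. *)
under eq_bigr => j _ do rewrite expr2 {1}flow_f.
by rewrite -mulr_sumr sum_flow /f divff // mul0r subr0 mulr1.
Qed.

Lemma h_0_ge2 : 2 <= h_0 R H.
Proof.
apply: lb_le_inf.
  (* [lb_le_inf] requires a nonempty set: the witness separates the first vertex from all the
     others. *)
  exists (#|subV H|%:R * #|edges_between [set ord0 : G] [set~ ord0]|%:R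
    / (#|[set ord0 : G]|%:R * #|[set ord_max : G]|%:R)).
  exists [set ord0], [set ord_max], [set ord0], [set~ ord0].
  split; rewrite ?cards1 ?subxx ?sub1set ?inE //.
  - rewrite /bipartition eqxx disjoints1 inE -val_eqE /=.
    by rewrite (ltn_eqF n_gt0).
  - by rewrite /bipartition setUCr eqxx -setI_eq0 setICr eqxx.
  - by split=> //; rewrite -val_eqE /= (gtn_eqF n_gt0).
move=> _ [H1 [H2 [G1 [G2 [/andP[/eqP H12 dH] bG [H1_gt0 sHG1] [H2_gt0 sHG2] ->]]]]].
have H_card : (#|H1| + #|H2| = 2)%N.
  by rewrite -(card_ends n_gt0) -[ends n]H12 -cardsUI disjoint_setI0 // cards0 addn0.
(* Both parts of [subV H] are singletons, so the quotient is twice the number of cut edges. *)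
have [-> ->] : #|H1| = 1%N /\ #|H2| = 1%N by lia.
have E_gt0 : (0 < #|edges_between G1 G2|)%N.
  apply: edges_between_gt0 bG _ _; first exact: path_connected.
    exact: leq_trans (subset_leq_card sHG1).
  exact: leq_trans (subset_leq_card sHG2).
rewrite (card_ends n_gt0) mulr1 divr1 ler_peMr // ler1n //.
Qed.

Lemma h_Kron_bounds : 0 <= h_Kron R H <= 2 / n%:R.
Proof.
rewrite /h_Kron; set E := (X in inf X).
(* Nonnegativity of the quotients bounds the infimum below and also provides the lower bound that
   [ge_inf] needs. *)
have lb0 : forall q, E q -> 0 <= q.
  move=> _ [H1 [H2 [_ _ _ ->]]].
  by rewrite divr_ge0 ?mulr_ge0 ?quad_form_ge0.
have in_end : E (2 / n%:R).
  exists [set ord_max], [set ord0]; rewrite !cards1 quad_form_end.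
  rewrite (card_ends n_gt0) mulr1 divr1; split=> //.
  rewrite /bipartition setUC eqxx disjoints1 inE -val_eqE /=.
  by rewrite (gtn_eqF n_gt0).
apply/andP; split; last by apply: ge_inf in_end; exists 0.
by apply: lb_le_inf lb0; exists (2 / n%:R).
Qed.

Lemma phi_Kron_bounds : 0 <= phi_Kron R H <= n%:R^-1.
Proof.
rewrite /phi_Kron; set E := (X in inf X).
have lb0 : forall q, E q -> 0 <= q.
  by move=> _ [H1 [_ _ _ ->]]; rewrite divr_ge0 ?quad_form_ge0.
have in_end : E n%:R^-1.
  exists [set ord_max]; rewrite !cards1 quad_form_end (card_ends n_gt0) divr1.
  by split=> //; [rewrite sub1set set22 | rewrite divff ?pnatr_eq0].
apply/andP; split; last by apply: ge_inf in_end; exists 0.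
by apply: lb_le_inf lb0; exists n%:R^-1.
Qed.

Lemma norm1_restr_ends (f : G -> R) :
  norm1 (restr (subV H) f) = `|f ord0| + `|f ord_max|.
Proof.
rewrite /norm1 -(sum_ends (fun v => `|f v|)) //.
by apply: eq_bigr => i _; rewrite mxE.
Qed.

Lemma phi_0_ge1 : 1 <= phi_0 R H.
Proof.
apply: lb_le_inf.
  (* Nonemptiness again, witnessed by the basis vector of the end minus that of the start. *)
  pose f (v : G) : R := (v == ord_max)%:R - (v == ord0)%:R.
  have f0 : f ord0 = -1 by rewrite /f -val_eqE /= (ltn_eqF n_gt0) sub0r.
  have fn : f ord_max = 1.
    by rewrite /f eqxx -val_eqE /= (gtn_eqF n_gt0) subr0.
  have norm_f : norm1 (restr (subV H) f) = 2.
    by rewrite norm1_restr_ends f0 fn normrN normr1.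
  exists (norm1 (matP R H *m (matB R H)^T *m restr (subV H) f)
          / norm1 (restr (subV H) f)), (restr (subV H) f).
  split=> //.
    apply/eqP => f_eq0; move: norm_f; rewrite f_eq0 /norm1 big1 => [|i _].
      by move/eqP; rewrite eq_sym pnatr_eq0.
    by rewrite mxE normr0.
  move=> y; have [g ->] := restr_surj y => flow_g.
  (* A kernel vector has zero total flow, hence one common value [a] at both ends, and
     [|-1 + a| + |1 + a| >= 2]. *)
  have := sum_flow g; rewrite flow_g big1 => [/esym/eqP|i _]; last by rewrite mxE.
  rewrite subr_eq0 => /eqP g0n.
  rewrite restrD norm_f norm1_restr_ends f0 fn g0n.
  have := ler_norm (1 + g ord0); have := ler_norm (- (-1 + g ord0)).
  by rewrite normrN; lra.
move=> _ [x [x0 x_perp ->]]; have [f def_x] := restr_surj x.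
move: x0 x_perp; rewrite {}def_x => x0 x_perp.
rewrite ler_pdivlMr ?norm1_gt0 // mul1r.
have norm_le : norm1 (restr (subV H) f) <= `|f ord_max - f ord0|.
  (* Orthogonality is tested on the constant [- f ord0], a kernel vector as its gradient vanishes.
     The shift makes the start value zero and leaves [|f ord_max - f ord0|] as the norm. *)
  have := x_perp (restr (subV H) (fun=> - f ord0)).
  rewrite restrD (norm1_restr_ends (fun v => f v - f ord0)) subrr normr0 add0r.
  apply; rewrite matP_grad (_ : grad _ = 0) ?mulmx0 //.
  by apply/colP => j; rewrite !mxE subrr.
by apply: le_trans norm_le _; rewrite -sum_flow ler_norm_sum.
Qed.

End Path.

Theorem proposition7p3 (R : realType) :
  ~ exists c : R,
      (forall (G : sgraph) (H : subgraph G),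
         graph_connected G -> (2 <= #|subV H|)%N ->
         h_0 R H <= c * h_Kron R H)
      \/
      (forall (G : sgraph) (H : subgraph G),
         graph_connected G -> (2 <= #|subV H|)%N ->
         phi_0 R H <= c * phi_Kron R H).
Proof.
(* One path, with [n > |c|] and [n > 0], refutes both inequalities. *)
case=> c; pose n := (Num.bound `|c|).+1.
have n_gt0 : (0 < n)%N by [].
have nR_gt0 : 0 < n%:R :> R by rewrite ltr0n.
have c_lt_n : c < n%:R.
  apply: le_lt_trans (ler_norm c) _.
  apply: lt_trans (archi_boundP (normr_ge0 c)) _.
  by rewrite ltr_nat.
(* Used with [a = 2] for the cut constants and [a = 1] for the others. Since [c < n] stays strict
   only after multiplication by a positive [t], the cases [c <= 0] and [t = 0] are treated apart. *)
have c_mul_lt (a t : R) : 0 < a -> 0 <= t <= a / n%:R -> c * t < a.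
  move=> a_gt0 /andP[t_ge0 t_le].
  have [c_le0|c_gt0] := lerP c 0.
    by apply: le_lt_trans a_gt0; rewrite mulr_le0_ge0.
  have [-> |t_neq0] := eqVneq t 0; first by rewrite mulr0.
  have t_gt0 : 0 < t by rewrite lt_def t_neq0.
  apply: (@lt_le_trans _ _ (n%:R * t)); first by rewrite ltr_pM2r.
  by rewrite mulrC -ler_pdivlMr.
have H_ge2 : (2 <= #|subV (path_ends n)|)%N by rewrite card_ends.
case=> /(_ _ (path_ends n) (@path_connected n) H_ge2); apply/negP; rewrite -ltNge.
  apply: lt_le_trans (h_0_ge2 R n_gt0).
  by apply: c_mul_lt => //; apply: h_Kron_bounds.
apply: lt_le_trans (phi_0_ge1 R n_gt0).
by apply: c_mul_lt => //; rewrite div1r; apply: phi_Kron_bounds.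
Qed.
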